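(* Let $n\ge 4$ and let $\Gamma=(G,\sigma)$ be a signed unicyclic graph on $n$ vertices. Then $EE(\Gamma)\le EE(\Gamma_n^{3+})$, with equality if and only if $\Gamma$ is switching equivalent to $\Gamma_n^{3+}$.
   Context: Graphs are finite and simple. A signed graph $\Gamma=(G,\sigma)$ is a graph $G$ together with a function $\sigma:E(G)\to\{-1,1\}$. Its adjacency matrix $A_\Gamma$ is the symmetric matrix with $(i,j)$ entry $\sigma(ij)$ if $ij\in E(G)$ and $0$ otherwise; the eigenvalues $\mu_1,\dots,\mu_n$ of $\Gamma$ are those of $A_\Gamma$, counted with multiplicity. The Estrada index is $EE(\Gamma)=\sum_{i=1}^n e^{\mu_i}$. A (signed) graph is unicyclic if it is connected and has the same number of vertices and edges. For $Z\subseteq V(\Gamma)$, switching with respect to $Z$ reverses the signs of all edges with exactly one endpoint in $Z$. Two signed graphs are called switching equivalent if one can be obtained from the other by switching, where signed graphs are considered up to isomorphism (relabelling of vertices). The sign of a cycle is the product of the signs of its edges. $\Gamma_n^{3+}$ denotes the signed graph on $n$ vertices obtained by identifying the center of the star $S_{n-2}$ (on $n-2$ vertices) with a vertex of a positive triangle; that is, a positive triangle with $n-3$ pendant edges attached at one of its vertices (the signs of the pendant edges are irrelevant up to switching). *)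

(* Defs.v *)
From HB Require Import structures.
From mathcomp Require Import all_boot all_order all_algebra.
From mathcomp Require Import reals sequences exp.
From mathcomp Require Import polyrcf complex.

Set Implicit Arguments.
Unset Strict Implicit.
Unset Printing Implicit Defensive.

Import Order.TTheory GRing.Theory Num.Theory.
Local Open Scope ring_scope.

Record graph (V : finType) := Graph {
  adj : rel V;
  adj_sym : symmetric adj;
  adj_irrefl : irreflexive adj
}.

Definition edges (V : finType) (G : graph V) : {set {set V}} :=
  [set [set x.1; x.2] | x : V * V & adj G x.1 x.2].

Definition connected (V : finType) (G : graph V) : Prop :=
  (0 < #|V|)%N /\ forall x y : V, connect (adj G) x y.

Definition unicyclic (V : finType) (G : graph V) : Prop :=
  connected G /\ #|edges G| = #|V|.

(* [negative e] means that the edge [e] has sign -1; the values of [negative]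
   on sets which are not edges carry no meaning, and every notion below only
   depends on its restriction to [edges underlying]. *)
Record signed_graph (V : finType) := SignedGraph {
  underlying :> graph V;
  negative : {set V} -> bool
}.

Definition edge_sign (R : pzRingType) (V : finType) (S : signed_graph V)
  (e : {set V}) : R := (-1) ^+ negative S e.

(* The vertices are listed in the order of [enum V]. *)
Definition adjacency (R : pzRingType) (V : finType) (S : signed_graph V) :
    'M[R]_#|V| :=
  \matrix_(i, j)
    let x := enum_val i in let y := enum_val j in
    if adj S x y then edge_sign R S [set x; y] else 0.

Lemma adjacency_sym (R : pzRingType) (V : finType) (S : signed_graph V) :
  (adjacency R S)^T = adjacency R S.
Proof. by apply/matrixP => i j; rewrite !mxE /= (adj_sym S) setUC. Qed.

(* The real roots of the characteristic polynomial, each one repeated according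
   to its multiplicity; [char_poly_eigenvalues] shows that none is missing when
   the matrix is symmetric. *)
Definition eigenvalues (R : rcfType) (n : nat) (A : 'M[R]_n) : seq R :=
  flatten [seq nseq (mup x (char_poly A)) x | x <- rootsR (char_poly A)].

Lemma char_poly_eigenvalues (R : rcfType) (n : nat) (A : 'M[R]_n) :
  A^T = A -> char_poly A = \prod_(mu <- eigenvalues A) ('X - mu%:P).
Proof.
move=> Asym.
have [s As] : exists s : seq R, char_poly A = \prod_(mu <- s) ('X - mu%:P).
  pose B := map_mx (real_complex R) A.
  have Bherm : B \is hermsymmx.
    apply: realsym_hermsym.
      apply/is_hermitianmxP; rewrite expr0 scale1r.
      by apply/matrixP=> i j; rewrite !mxE -{1}Asym mxE.
    by apply/mxOverP => i j; rewrite mxE complex_real.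
  have /orthomx_spectralP := hermitian_normalmx Bherm.
  have dR := hermitian_spectral_diag_real Bherm.
  have := spectral_unit B.
  set P := spectralmx B; set d := spectral_diag B in dR * => Pu BE.
  have BP : char_poly B = \prod_(i < n) ('X - (d 0 i)%:P).
    pose M := map_mx (@polyC R[i]) : 'M_n -> 'M_n.
    have MP : M P \in unitmx by rewrite map_unitmx.
    have -> : char_poly B = char_poly (diag_mx d).
      rewrite /char_poly; suff -> : char_poly_mx B =
          invmx (M P) *m char_poly_mx (diag_mx d) *m M P.
        by rewrite !det_mulmx mulrAC -det_mulmx mulVmx // det1 mul1r.
      rewrite /char_poly_mx {1}BE !map_mxM map_invmx -/(M P).
      rewrite mulmxBr mulmxBl; congr (_ - _).
      by rewrite scalar_mxC -mulmxA mulVmx // mulmx1.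
    rewrite char_poly_trig ?diag_mx_is_trig //.
    by apply: eq_bigr => i _; rewrite mxE eqxx mulr1n.
  exists [seq complex.Re (d 0 i) | i <- enum 'I_n].
  apply: (map_poly_inj (real_complex R)).
  rewrite map_char_poly BP big_map big_enum rmorph_prod /=.
  apply: eq_bigr => i _; rewrite rmorphB /= map_polyX map_polyC /=.
  by rewrite -[in LHS](RRe_real (mxOverP dR 0 i)).
have A0 : char_poly A != 0 by rewrite monic_neq0 ?char_poly_monic.
rewrite [LHS]As; apply: perm_big; apply/allP => x _ /=; apply/eqP.
rewrite /eigenvalues count_flatten -map_comp -[LHS]mu_prod_XsubC -As.
rewrite (eq_map (g := fun y => (y == x) * mup x (char_poly A))%N); last first.
  by move=> y /=; rewrite count_nseq /=; case: eqP => [->|].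
have xr : (x \in rootsR (char_poly A)) = root (char_poly A) x.
  by rewrite -(roots_on_rootsR A0) in_itv.
have -> (t : seq R) m :
    sumn [seq ((y == x) * m)%N | y <- t] = (count_mem x t * m)%N.
  by elim: t => //= y t ->; rewrite mulnDl.
rewrite count_uniq_mem ?uniq_roots // xr.
by case: (boolP (root _ x)) => [_|/mupNroot ->]; rewrite ?mul1n ?muln0.
Qed.

Definition EE (R : realType) (V : finType) (S : signed_graph V) : R :=
  \sum_(mu <- eigenvalues (adjacency R S)) expR mu.

(* For an edge [e], [#|e :&: Z| == 1] says that exactly one endpoint of [e]
   lies in [Z]. *)
Definition switch (V : finType) (Z : {set V}) (S : signed_graph V) :
    signed_graph V :=
  SignedGraph (underlying S) (fun e => negative S e (+) (#|e :&: Z| == 1%N)).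

Definition isomorphic (V W : finType) (S : signed_graph V)
    (T : signed_graph W) : Prop :=
  exists f : V -> W,
    [/\ bijective f,
        forall x y, adj T (f x) (f y) = adj S x y &
        forall e, e \in edges S -> negative T (f @: e) = negative S e].

Definition switching_equivalent (V W : finType) (S : signed_graph V)
    (T : signed_graph W) : Prop :=
  exists Z : {set V}, isomorphic (switch Z S) T.

(* Vertex 0 is adjacent to all the other ones, and 1 is adjacent to 2: the
   triangle is {0, 1, 2} and 3, ..., n - 1 are pendant at 0. *)
Definition Gamma3_adj (n : nat) : rel 'I_n := fun i j =>
  (i != j) && [|| (i == 0 :> nat)%N, (j == 0 :> nat)%N | (i <= 2) && (j <= 2)]%N.

Lemma Gamma3_adj_sym n : symmetric (@Gamma3_adj n).
Proof.
by move=> i j; rewrite /Gamma3_adj eq_sym orbCA [(i <= 2)%N && _]andbC.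
Qed.

Lemma Gamma3_adj_irrefl n : irreflexive (@Gamma3_adj n).
Proof. by move=> i; rewrite /Gamma3_adj eqxx. Qed.

Definition Gamma3_graph (n : nat) : graph 'I_n :=
  Graph (@Gamma3_adj_sym n) (@Gamma3_adj_irrefl n).

Definition Gamma3_plus (n : nat) : signed_graph 'I_n :=
  SignedGraph (Gamma3_graph n) (fun=> false).

(* Main.v *)
Require Import Defs.
From mathcomp Require Import boolp classical_sets reals topology normedtype.
From mathcomp Require Import sequences.
From mathcomp Require Import all_boot all_order all_algebra.
From mathcomp Require Import complex zify ring lra.

(** The Estrada index is the sum over k of tr(A^k)/k!, and tr(A^k) is a signed
    count of closed walks of length k, hence at most the number of closed walks
    of the underlying graph.  Let v be a leaf attached at u, let w(k) be the
    number of closed walks of length k at u that avoid v, and c(k) the number of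
    those at v.  Then c(0) = 1, c(1) = 0 and c(k+2) = (w * c)(k) for the Cauchy
    product, and removing v decreases tr(A^(k+2)) by
    c(k+2) + ((s+1)w(s) * c)(k).  This is monotone in w and, by induction on the
    number of vertices, w is at most the corresponding sequence for the center
    of the triangle with pendant edges.  So stripping the leaves reduces the
    comparison to the cycle of the graph, say of length m.  If m = 3, nothing is
    left to compare, and every moment is dominated.  If m >= 4, some moments
    may be larger than those of the extremal graph (C_4 has more closed walks of
    length 4 than the triangle with one pendant edge), but the six closed walks
    of length 3 in the latter outweigh this in the sum of the tr(A^k)/k!.
    Equality forces m = 3 and then, by the fourth moments, a vertex adjacent to
    all the other ones; the third moments say that the triangle is positive. *)

Set Implicit Arguments.
Unset Strict Implicit.
Unset Printing Implicit Defensive.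

(** * Cauchy products and walks *)

Definition conv (f h : nat -> nat) (k : nat) : nat :=
  \sum_(i < k.+1) f i * h (k - i).

(** Coefficients up to [k] ignore any truncation above [k], so commutativity and associativity of
    [conv] come from polynomials. *)
Lemma conv_coef f h k n : k < n ->
  conv f h k = (((\poly_(i < n) f i) * (\poly_(i < n) h i))`_k)%R.
Proof.
move=> kn; rewrite coefM; apply: eq_bigr => i _; rewrite !coef_poly.
have := ltn_ord i; rewrite ltnS => ik.
by rewrite (leq_ltn_trans ik kn) (leq_ltn_trans (leq_subr _ _) kn).
Qed.

Lemma eq_conv f f' h h' k : (forall i, i <= k -> f i = f' i) ->
  (forall i, i <= k -> h i = h' i) -> conv f h k = conv f' h' k.
Proof.
move=> ff' hh'; apply: eq_bigr => i _.
by rewrite ff' ?hh' ?leq_subr // -ltnS.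
Qed.

Lemma leq_conv f f' h h' k : (forall i, i <= k -> f i <= f' i) ->
  (forall i, i <= k -> h i <= h' i) -> conv f h k <= conv f' h' k.
Proof.
move=> ff' hh'; apply: leq_sum => i _.
by rewrite leq_mul ?ff' ?hh' ?leq_subr // -ltnS.
Qed.

Lemma convC f h k : conv f h k = conv h f k.
Proof. by rewrite !(@conv_coef _ _ _ k.+1) // GRing.mulrC. Qed.

Lemma coef_conv f h n k : k < n ->
  ((\poly_(i < n) conv f h i)`_k)%R =
  (((\poly_(i < n) f i) * (\poly_(i < n) h i))`_k)%R.
Proof. by move=> kn; rewrite coef_poly kn; apply: conv_coef. Qed.

Lemma convA f h l k : conv f (conv h l) k = conv (conv f h) l k.
Proof.
rewrite !(@conv_coef _ _ _ k.+1) //.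
set P := fun f : nat -> nat => (\poly_(i < k.+1) f i)%R.
transitivity (((P f * (P h * P l))`_k)%R).
  rewrite !coefM; apply: eq_bigr => i _.
  by rewrite coef_conv // ltnS leq_subr.
rewrite GRing.mulrA !coefM; apply: eq_bigr => i _.
by rewrite coef_conv.
Qed.

Lemma conv_shift f h k : h 0 = 0 -> conv f h k.+1 = conv f (fun i => h i.+1) k.
Proof.
move=> h0; rewrite /conv big_ord_recr /= subnn h0 muln0 addn0.
by apply: eq_bigr => i _; rewrite subSn // -ltnS.
Qed.

Lemma conv_recl f h k :
  conv f h k.+1 = f 0 * h k.+1 + conv (fun i => f i.+1) h k.
Proof. by rewrite /conv big_ord_recl subn0. Qed.

Lemma conv_suml (I : finType) (P : pred I) (f : I -> nat -> nat) h k :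
  conv (fun i => \sum_(j | P j) f j i) h k = \sum_(j | P j) conv (f j) h k.
Proof.
by rewrite exchange_big; apply: eq_bigr => i _; rewrite big_distrl.
Qed.

Section Walks.
Variable V : finType.
Implicit Types (a : rel V) (x y z : V).

Fixpoint wk a k x y : nat :=
  if k is k'.+1 then \sum_(z | a x z) wk a k' z y else x == y.

Definition trace_wk a k : nat := \sum_x wk a k x x.

Lemma eq_wk a b : a =2 b -> forall k x y, wk a k x y = wk b k x y.
Proof.
move=> ab; elim=> [|k IH] x y //=.
by apply: eq_big => [z|z _]; [exact: ab | exact: IH].
Qed.

Lemma wkS a k x y : wk a k.+1 x y = \sum_(z | a x z) wk a k z y.
Proof. by []. Qed.

Lemma wk0 a x y : wk a 0 x y = (x == y).
Proof. by []. Qed.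

Lemma wkD a k l x y : wk a (k + l) x y = \sum_z wk a k x z * wk a l z y.
Proof.
elim: k x => [|k IH] x /=.
  rewrite (bigD1 x) //= eqxx mul1n big1 ?addn0 // => z zx.
  by rewrite eq_sym (negbTE zx).
rewrite (eq_bigr _ (fun z _ => IH z)) exchange_big /=.
by apply: eq_bigr => z _; rewrite big_distrl.
Qed.

Lemma wk1 a x y : wk a 1 x y = a x y.
Proof.
rewrite /= big_mkcond (bigD1 y) //= eqxx big1 ?addn0; first by case: (a x y).
by move=> z /negbTE ->; case: (a x z).
Qed.

Lemma wk_recr a k x y : wk a k.+1 x y = \sum_(z | a z y) wk a k x z.
Proof.
rewrite -addn1 wkD [RHS]big_mkcond; apply: eq_bigr => z _; rewrite wk1.
by case: (a z y); rewrite ?muln1 ?muln0.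
Qed.

Lemma wk_sym a : symmetric a -> forall k x y, wk a k x y = wk a k y x.
Proof.
move=> sa; elim=> [|k IH] x y; first by rewrite /= eq_sym.
by rewrite wk_recr /=; apply: eq_big => [z|z _]; rewrite 1?sa.
Qed.

Fixpoint first_passage a z k x : nat :=
  if k is k'.+1 then (x != z) * \sum_(t | a x t) first_passage a z k' t
  else x == z.

(** Cut a walk at its first visit to [z]. Walks that avoid [z] are missed, whence only an
    inequality; there are none when the walk ends at [z]. *)
Lemma first_passage_le a z k x y :
  conv (fun i => first_passage a z i x) (fun i => wk a i z y) k <= wk a k x y.
Proof.
elim: k x => [|k IH] x.
  by rewrite /conv big_ord1 /=; case: (x =P z) => [->|_]; rewrite ?mul1n ?mul0n.
rewrite conv_recl; case: (x =P z) => [->|/eqP xz].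
  rewrite [first_passage a z 0 z]/= eqxx mul1n [conv _ _ k]big1 ?addn0 //.
  by move=> i _; rewrite /= eqxx.
rewrite /= (negbTE xz) mul0n add0n /= -/(wk a).
under eq_conv => [i _|i _] do [rewrite /= mul1n|over].
by rewrite conv_suml; apply: leq_sum => t _; exact: IH.
Qed.

Lemma first_passageE a z k x :
  conv (fun i => first_passage a z i x) (fun i => wk a i z z) k = wk a k x z.
Proof.
elim: k x => [|k IH] x.
  by rewrite /conv big_ord1 /= eqxx muln1.
rewrite conv_recl; case: (x =P z) => [->|/eqP xz].
  rewrite [first_passage a z 0 z]/= eqxx mul1n [conv _ _ k]big1 ?addn0 //.
  by move=> i _; rewrite /= eqxx.
rewrite /= (negbTE xz) mul0n add0n /= -/(wk a).
under eq_conv => [i _|i _] do [rewrite /= mul1n|over].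
by rewrite conv_suml; apply: eq_bigr => t _; exact: IH.
Qed.

(* The difference of the two sides counts the pairs of a closed walk at [x] and
   a closed walk at [u] avoiding [x]. *)
Lemma conv_wk_le a u x k : symmetric a ->
  conv (fun i => wk a i x u) (fun i => wk a i x u) k <=
  conv (fun i => wk a i x x) (fun i => wk a i u u) k.
Proof.
move=> sa; set F := fun i => first_passage a x i u.
(* A closed walk at [u] through [x] is a first passage [F] to [x] followed by a walk back to [u].
   Regrouping [F] with the closed walk at [x] yields a full walk between [u] and [x]. *)
apply: (@leq_trans (conv (fun i => wk a i x x)
  (conv F (fun i => wk a i x u)) k)); last first.
  by apply: leq_conv => i _ //; exact: first_passage_le.
rewrite convA; apply: leq_conv => i _ //.
by rewrite convC first_passageE (wk_sym sa).
Qed.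

(** Vertices outside [S] stay as isolated points, so that removals do not change the type. They keep
    their walk of length 0. *)
Definition res (g : rel V) (S : {set V}) : rel V :=
  fun x y => [&& x \in S, y \in S & g x y].

Lemma res_sym g (S : {set V}) : symmetric g -> symmetric (res g S).
Proof. by move=> sg x y; rewrite /res sg andbCA. Qed.

Lemma resT g : res g [set: V] =2 g.
Proof. by move=> x y; rewrite /res !inE. Qed.

Lemma wk_out g (S : {set V}) k x y : x \notin S -> wk (res g S) k.+1 x y = 0.
Proof. by move=> xS; rewrite /= big1 // => z; rewrite /res (negbTE xS). Qed.

(** * Walks and the removal of a leaf *)

Section Leaf.
Variables (g : rel V) (S : {set V}) (u v : V).
Hypotheses (sg : symmetric g) (vS : v \in S) (uS : u \in S) (uv : u != v)
  (leaf : forall y, y \in S -> g v y = (y == u)).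

Let W := wk (res g S).
Let W' := wk (res g (S :\ v)).

Lemma wk_leaf k y : W k.+1 v y = W k u y.
Proof.
rewrite /W /= (big_pred1 u) // => z; rewrite /res vS /=.
case: (boolP (z \in S)) => [/leaf//|zS].
by apply/esym; apply: contraNF zS => /eqP->.
Qed.

Lemma sum_res_leaf (f : V -> nat) x : x != v ->
  \sum_(z | res g S x z) f z =
  (x == u) * f v + \sum_(z | res g (S :\ v) x z) f z.
Proof.
move=> xv; rewrite big_mkcond (bigD1 v) //=; congr (_ + _).
  rewrite /res vS /= sg; case: (boolP (x \in S)) => [/leaf->|xS] /=.
    by case: eqP; rewrite ?mul1n ?mul0n.
  by rewrite (_ : (x == u) = false) //; apply: contraNF xS => /eqP->.
rewrite [RHS]big_mkcond [RHS](bigD1 v) //= {2}/res !inE eqxx andbF add0n.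
by apply: eq_bigr => z zv; rewrite /res !inE xv zv.
Qed.

(** Split at the first visit to [v], which comes right after a visit to [u]; the step from [u] to
    [v] explains the drop from [k.+1] to [k]. *)
Lemma wk_nonleaf k x y : x != v ->
  W k.+1 x y = W' k.+1 x y + conv (fun i => W' i x u) (fun i => W i v y) k.
Proof.
move=> xv; elim: k x xv => [|k IH] x xv.
  rewrite /W wkS sum_res_leaf // /conv big_ord1 /= addnC.
  by congr (_ + _).
rewrite /W wkS sum_res_leaf // -/W conv_recl addnCA.
congr (_ + _); rewrite /W' [in RHS]wkS -/W'.
under [in RHS]eq_conv => [i _|i _] do [rewrite /W' wkS|over].
rewrite conv_suml -big_split; apply: eq_bigr => z.
by rewrite /res !inE => /andP[_ /andP[/andP[zv _] _]]; exact: IH.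
Qed.

Lemma wk'_v k x : x != v -> W' k x v = 0.
Proof.
move=> xv; case: k => [|k]; first by rewrite /W' /= (negbTE xv).
by rewrite /W' (wk_sym (res_sym _ sg)) wk_out // !inE eqxx.
Qed.

Lemma wk_leaf_closed0 : W 1 v v = 0.
Proof. by rewrite wk_leaf /W /= (negbTE uv). Qed.

Lemma wk_leaf_closed k :
  W k.+2 v v = conv (fun i => W' i u u) (fun i => W i v v) k.
Proof. by rewrite wk_leaf wk_nonleaf // wk'_v. Qed.

(** Cutting at the first and last visits to [v] leaves a closed walk at [v] between two walks
    joining [x] and [u] that avoid [v]. *)
Lemma wk_nonleaf_closed k x : x != v ->
  W k.+2 x x = W' k.+2 x x +
    conv (conv (fun i => W' i x u) (fun i => W' i x u)) (fun i => W i v v) k.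
Proof.
move=> xv; rewrite wk_nonleaf //; congr (_ + _).
rewrite conv_shift; last by rewrite /W /= eq_sym (negbTE xv).
rewrite -convA; apply: eq_conv => i _ //.
by rewrite /W (wk_sym (res_sym _ sg)) -/W wk_nonleaf // wk'_v.
Qed.

(** The outer pieces of a closed walk through [v] join at [x] into a closed walk at [u] avoiding
    [v]. If it has length [i], then [x] may sit at any of [i.+1] positions, which gives the
    weight. *)
Lemma trace_wk_leaf k :
  trace_wk (res g S) k.+2 = trace_wk (res g (S :\ v)) k.+2 + (W k.+2 v v +
    conv (fun i => i.+1 * W' i u u) (fun i => W i v v) k).
Proof.
rewrite /trace_wk (bigD1 v) //= [in RHS](bigD1 v) //= -!/(wk _ _.+2 _ _).
rewrite -[X in X + _ = _]/(W k.+2 v v).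
rewrite [X in _ = X + _ + _]wk_out ?add0n ?inE ?eqxx // addnCA; congr (_ + _).
rewrite (eq_bigr _ (fun x xv => wk_nonleaf_closed k xv)) big_split /=.
congr (_ + _); rewrite -conv_suml; apply: eq_conv => i _ //.
(* The sum may include [x = v], as no walk avoiding [v] joins it to [u]. *)
transitivity (\sum_x conv (fun j => W' j x u) (fun j => W' j x u) i).
  rewrite [RHS](bigD1 v) //= [X in X + _]big1 // => j _.
  by rewrite /W' (wk_sym (res_sym _ sg)) -/W' wk'_v.
rewrite exchange_big /=.
rewrite (eq_bigr (fun _ => W' i u u)); first by rewrite sum_nat_const card_ord.
move=> j _; have ji : j <= i by rewrite -ltnS.
rewrite -[in RHS](subnKC ji) {3}/W' wkD; apply: eq_bigr => x _.
by rewrite {1}/W' (wk_sym (res_sym _ sg)).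
Qed.

End Leaf.
End Walks.

Arguments wk : simpl never.

(** * Leaves and two-regular cores *)

Section Unicyclic.
Variable V : finType.
Implicit Types (a g : rel V) (S B : {set V}) (x y z u v : V).

Lemma wk2 a x : symmetric a -> wk a 2 x x = #|[set y | a x y]|.
Proof.
move=> sa; rewrite wkS cardsE -sum1_card; apply: eq_big => // y xy.
by rewrite wk1 sa xy.
Qed.

Lemma wk1_closed g S x : irreflexive g -> wk (res g S) 1 x x = 0.
Proof. by move=> ig; rewrite wk1 /res ig !andbF. Qed.

Lemma trace_wk_in g S k :
  trace_wk (res g S) k.+1 = \sum_(x in S) wk (res g S) k.+1 x x.
Proof.
rewrite /trace_wk [RHS]big_mkcond; apply: eq_bigr => x _.
by case: (boolP (x \in S)) => // xS; rewrite wk_out.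
Qed.

(* Connectedness of the graph induced on [S], as the absence of a cut: this
   form is stable under the removal of a leaf for immediate reasons. *)
Definition uncut g S := forall B, B \subset S -> B != set0 -> B != S ->
  exists x y, [/\ x \in B, y \in S, y \notin B & g x y].

(** For a simple graph the trace of the square is the sum of the degrees, so the last clause equates
    the numbers of edges and vertices. *)
Definition unicyclic_on g S :=
  [/\ S != set0, uncut g S & trace_wk (res g S) 2 = 2 * #|S|].

Definition two_regular_on g S := forall x, x \in S -> wk (res g S) 2 x x = 2.

Definition is_leaf g S v u :=
  [/\ v \in S, u \in S, u != v & forall y, y \in S -> g v y = (y == u)].

(** Connectedness makes every degree positive, and the average degree is 2. Without a vertex of
    degree 1, all degrees are at least 2, hence equal to 2. *)
Lemma leaf_or_two_regular g S : symmetric g -> irreflexive g ->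
  unicyclic_on g S -> (exists v u, is_leaf g S v u) \/ two_regular_on g S.
Proof.
move=> sg ig [S0 cS tS]; have sr := res_sym S sg.
have pos x : x \in S -> 0 < wk (res g S) 2 x x.
  move=> xS; have [] : exists y, res g S x y.
    have [xE|xN] := eqVneq [set x] S.
      move: tS; rewrite -xE cards1 trace_wk_in big_set1 wkS big1 // => y.
      by rewrite /res !inE => /and3P[_ /eqP->]; rewrite ig.
    have [|||z [y [/set1P-> yS _ xy]]] := cS [set x].
    - by rewrite sub1set.
    - by apply/set0Pn; exists x; rewrite inE.
    - by [].
    by exists y; rewrite /res xS yS.
  by move=> y xy; rewrite wk2 // card_gt0; apply/set0Pn; exists y; rewrite inE.
have [/existsP[v /andP[vS dv]]|noleaf] :=
    boolP [exists v, (v \in S) && (wk (res g S) 2 v v == 1)].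
  left; exists v; move: dv; rewrite wk2 // => /cards1P[u uE]; exists u.
  have vu y : res g S v y = (y == u).
    by move/setP/(_ y): uE; rewrite !inE.
  have := vu u; rewrite eqxx => /and3P[_ uS guv]; split=> //.
    by apply: contraTneq guv => ->; rewrite ig.
  by move=> y yS; rewrite -vu /res vS yS.
right=> x xS.
have ge2 y : y \in S -> 2 <= wk (res g S) 2 y y.
  move=> yS; have := pos _ yS; move/existsPn/(_ y): noleaf; rewrite yS /=.
  by case: (wk _ _ _ _) => [|[|]].
apply/eqP; rewrite eqn_leq ge2 // andbT.
move: tS; rewrite trace_wk_in (big_setD1 x xS) (cardsD1 x) xS /= => tS.
have : \sum_(y in S :\ x) 2 <= \sum_(y in S :\ x) wk (res g S) 2 y y.
  by apply: leq_sum => y; rewrite !inE => /andP[_]; exact: ge2.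
by rewrite sum_nat_const; lia.
Qed.

Lemma unicyclic_on_leaf g S v u : symmetric g -> is_leaf g S v u ->
  unicyclic_on g S -> unicyclic_on g (S :\ v).
Proof.
move=> sg [vS uS uv leaf] [S0 cS tS]; split.
- by apply/set0Pn; exists u; rewrite !inE uv.
- move=> B BS B0 BN.
  have vB : v \notin B by apply/negP => /(subsetP BS); rewrite !inE eqxx.
  have BS' : B \subset S by apply: subset_trans BS (subsetDl _ _).
  have uBv y : y \in S -> g v y -> y = u by move=> yS; rewrite leaf // => /eqP.
  (* If [u] is in [B], the edge leaving [B] could be the one to [v], so [v] is added to [B] first.
     Otherwise an edge from [B] to [v] would put [u] in [B]. *)
  have [uB|uB] := boolP (u \in B).
    have [|||x [y [xB yS yB xy]]] := cS (v |: B).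
    + by rewrite subUset sub1set vS.
    + by apply/set0Pn; exists v; rewrite !inE eqxx.
    + apply: contraNneq BN => <-; apply/eqP/setP => y.
      by rewrite !inE; case: (y =P v) => [->|]//=; rewrite (negbTE vB).
    move: xB yB; rewrite !inE negb_or => /orP[/eqP xv|xB] /andP[yv yB].
      by move: yB; rewrite (uBv y) ?uB // -xv.
    by exists x, y; rewrite !inE yv.
  have [|||x [y [xB yS yB xy]]] := cS B => //.
    by apply: contraNneq vB => ->.
  exists x, y; rewrite !inE yS; split=> //; rewrite andbT.
  apply: contraNneq uB => yv; rewrite -(uBv x) //; first exact: (subsetP BS').
  by rewrite -yv sg.
move: tS; rewrite (trace_wk_leaf sg vS uS uv leaf) (cardsD1 v) vS.
by rewrite (wk_leaf_closed sg vS uS uv leaf) /conv !big_ord1 !wk0 !eqxx /=; lia.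
Qed.

(** * Walks in two-regular graphs *)

Section TwoRegular.
Variables (g : rel V) (S : {set V}).
Hypotheses (sg : symmetric g) (ig : irreflexive g) (rS : two_regular_on g S).
Let W := wk (res g S).
Let sr := res_sym S sg.

Lemma regular_sum_wk k x : x \in S -> \sum_y W k x y = 2 ^ k.
Proof.
elim: k x => [|k IH] x xS.
  rewrite (bigD1 x) //= /W wk0 eqxx big1 // => y.
  by rewrite wk0 eq_sym => /negbTE->.
rewrite /W; under eq_bigr do rewrite wkS.
rewrite exchange_big (eq_bigr (fun=> 2 ^ k)) => [|y]; last first.
  by case/and3P=> _ yS _; exact: IH.
by rewrite sum_nat_const expnS; congr (_ * _); rewrite -(rS xS) wk2 // cardsE.
Qed.

(** Read backwards from [x]: the first [k] steps have two choices each, and the last one must lead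
    to [z]. *)
Lemma regular_wk_le k z x : x \in S -> W k.+1 z x <= 2 ^ k.
Proof.
move=> xS; rewrite -(regular_sum_wk k xS) /W wkS [leqLHS]big_mkcond.
apply: leq_sum => y _; rewrite (wk_sym sr k x y).
by case: ifP.
Qed.

Lemma regular_trace_le k : trace_wk (res g S) k.+1 <= #|S| * 2 ^ k.
Proof.
rewrite trace_wk_in -sum_nat_const.
by apply: leq_sum => x xS; exact: regular_wk_le.
Qed.

Lemma regular_neighbours x y z t : x \in S -> res g S x y -> res g S x z ->
  y != z -> res g S x t -> (t == y) || (t == z).
Proof.
move=> xS xy xz yz xt; have := rS xS; rewrite wk2 // => c2.
have : [set y; z] == [set t | res g S x t].
  rewrite eqEcard c2 cards2 yz leqnn andbT.
  by apply/subsetP => t' /set2P[]->; rewrite inE.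
by move/eqP/setP/(_ t); rewrite !inE xt => ->.
Qed.

(** The three vertices of such a walk have all their neighbours among themselves, so no edge leaves
    them and they fill [S]. *)
Lemma regular_triangle x : uncut g S -> x \in S -> W 3 x x != 0 ->
  #|S| = 3 /\ {in S &, forall y z, g y z = (y != z)}.
Proof.
move=> cS xS; rewrite /W wkS sum_nat_eq0 => /forallPn[y].
rewrite negb_imply => /andP[xy]; rewrite wkS sum_nat_eq0 => /forallPn[z].
rewrite negb_imply wk1 => /andP[yz]; rewrite eqb0 negbK => zx.
have [yx zy xz] : [/\ res g S y x, res g S z y & res g S x z].
  by rewrite ![res _ _ _ x]sr ![res _ _ z y]sr [res _ _ x z]sr.
have ne p q : res g S p q -> p != q.
  by case/and3P=> _ _; apply: contraTneq => ->; rewrite ig.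
have [[xy' yz'] zx'] := (ne _ _ xy, ne _ _ yz, ne _ _ zx).
have yS : y \in S by case/and3P: xy.
have zS : z \in S by case/and3P: xz.
have SE : S = [set x; y; z].
  apply/esym/eqP; apply/negPn/negP => BS.
  have [||//|p [q [pB qS qB pq]]] := cS [set x; y; z].
  - by rewrite !subUset !sub1set xS yS zS.
  - by apply/set0Pn; exists x; rewrite !inE eqxx.
  have pS : p \in S by move: pB; rewrite !inE -orbA => /or3P[]/eqP->.
  have {pq}pq : res g S p q by rewrite /res pS qS.
  move: qB; rewrite !inE -orbA => /norP[qx /norP[qy qz]].
  move: pB; rewrite !inE -orbA => /or3P[]/eqP pE; rewrite pE in pq.
  - have := regular_neighbours xS xy xz yz' pq.
    by rewrite (negbTE qy) (negbTE qz).
  - have := regular_neighbours yS yz yx zx' pq.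
    by rewrite (negbTE qx) (negbTE qz).
  - have := regular_neighbours zS zx zy xy' pq.
    by rewrite (negbTE qx) (negbTE qy).
split.
  rewrite SE setUC cardsU1 cards2 xy' !inE (negbTE zx') eq_sym (negbTE yz') //.
move=> p q; have [-> _ _|pq] := eqVneq p q; first by rewrite ig.
have gE s t : res g S s t -> g s t /\ g t s.
  by case/and3P => _ _ st; split; rewrite // sg.
have [[[gxy gyx] [gyz gzy]] [gzx gxz]] := (gE _ _ xy, gE _ _ yz, gE _ _ zx).
rewrite {1 2}SE !inE -!orbA => /or3P[]/eqP pE /or3P[]/eqP qE; move: pq;
  by rewrite pE qE ?eqxx ?gxy ?gyx ?gyz ?gzy ?gzx ?gxz.
Qed.

Lemma regular_triangle_free x : uncut g S -> #|S| != 3 -> W 3 x x = 0.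
Proof.
move=> cS S3; have [xS|xS] := boolP (x \in S); last exact: wk_out.
by apply/eqP; apply: contraNT S3 => /(regular_triangle cS xS)[->].
Qed.

(** Split after two steps. The point reached is not [x], as there is no closed walk of length 3; two
    of the four walks of length 2 remain, each with at most 4 completions. *)
Lemma regular_wk5 x : uncut g S -> #|S| != 3 -> x \in S -> W 5 x x <= 8.
Proof.
move=> cS S3 xS; rewrite /W (wkD _ 2 3) (bigD1 x) //=.
rewrite -[X in _ * X + _]/(W 3 x x) regular_triangle_free // muln0 add0n.
have := regular_sum_wk 2 xS; rewrite (bigD1 x) //= {1}/W rS // => sE.
apply: (@leq_trans (\sum_(z | z != x) W 2 x z * 4)).
  apply: leq_sum => z _; rewrite leq_mul2l; apply/orP; right.
  exact: (regular_wk_le 2).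
by rewrite -big_distrl /=; lia.
Qed.

End TwoRegular.

(** Walks in a triangle: the closed ones at a vertex, then those between two given distinct
    vertices. *)
Definition triangle_walks k :=
  iter k (fun pq => (2 * pq.2, pq.1 + pq.2)) (1, 0).

Lemma wk_triangle g S : #|S| = 3 -> {in S &, forall y z, g y z = (y != z)} ->
  forall k, {in S &, forall x y, wk (res g S) k x y =
    if x == y then (triangle_walks k).1 else (triangle_walks k).2}.
Proof.
move=> S3 gE; elim=> [|k IH] x y xS yS; first by rewrite wk0; case: eqP.
rewrite wkS (eq_bigl [pred z | (z \in S) && (z != x)]); last first.
  move=> z; rewrite /res xS /= eq_sym.
  by case: (boolP (z \in S)) => //= zS; rewrite gE.
rewrite [triangle_walks k.+1]iterS -/(triangle_walks k) /=.
have cx : #|S :\ x| = 2 by move: S3; rewrite (cardsD1 x) xS; lia.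
have [<-|xy] := eqVneq x y.
  rewrite (eq_bigr (fun=> (triangle_walks k).2)) => [|z /andP[zS /negbTE zx]].
    rewrite sum_nat_const -cx; congr (_ * _).
    by apply: eq_card => z; rewrite !inE andbC.
  by rewrite IH // zx.
rewrite (bigD1 y) /= ?yS 1?eq_sym // IH // eqxx; congr (_ + _).
rewrite (eq_bigr (fun=> (triangle_walks k).2)) => [|z].
  rewrite sum_nat_const -[RHS]mul1n; congr (_ * _).
  have : #|S :\ x :\ y| = 1.
    by move: cx; rewrite (cardsD1 y) !inE eq_sym xy yS => -[].
  move=> <-; apply: eq_card => z; rewrite !inE unfold_in.
  by case: (z == x); case: (z == y); case: (z \in S).
by case/andP=> /andP[zS _] /negbTE zy; rewrite IH // zy.
Qed.

End Unicyclic.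

Lemma trace_wk0 (V : finType) (a : rel V) : trace_wk a 0 = #|V|.
Proof.
by rewrite -sum1_card; apply: eq_bigr => x _; rewrite wk0 eqxx.
Qed.

Lemma trace_wk1 (V : finType) (g : rel V) (S : {set V}) :
  irreflexive g -> trace_wk (res g S) 1 = 0.
Proof. by move=> ig; rewrite /trace_wk big1 // => x _; rewrite wk1_closed. Qed.

(** The last factor is the degree of [u] without [v]: the fourth moment detects it, which settles
    the equality case. *)
Lemma leaf_trace4 (V : finType) (g : rel V) (S : {set V}) v u :
  symmetric g -> irreflexive g -> is_leaf g S v u ->
  trace_wk (res g S) 4 =
  trace_wk (res g (S :\ v)) 4 + 2 + 4 * wk (res g (S :\ v)) 2 u u.
Proof.
move=> sg ig [vS uS uv leaf].
rewrite (trace_wk_leaf sg vS uS uv leaf) (wk_leaf_closed sg vS uS uv leaf).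
rewrite /conv !big_ord_recl !big_ord0 /= !subn0 /bump /=.
rewrite (wk_leaf_closed sg vS uS uv leaf) /conv big_ord1 !wk1_closed // !wk0.
by rewrite !eqxx /= (_ : 1 + (1 + 0) = 2) //; lia.
Qed.

(** * Adding a leaf to two graphs in parallel *)

Section LeafComparison.
Variables (V V' : finType) (g : rel V) (h : rel V').
Hypotheses (sg : symmetric g) (sh : symmetric h).
Variables (S : {set V}) (S' : {set V'}) (v u : V) (v' u' : V').
Hypotheses (vu : is_leaf g S v u) (vu' : is_leaf h S' v' u').

Lemma leaf_closed_le :
  (forall k, wk (res g (S :\ v)) k u u <= wk (res h (S' :\ v')) k u' u') ->
  forall k, wk (res g S) k v v <= wk (res h S') k v' v'.
Proof.
move=> le; have [vS uS uv lv] := vu; have [vS' uS' uv' lv'] := vu'.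
elim/ltn_ind => -[|[|k]] IH.
- by rewrite !wk0 !eqxx.
- by rewrite (wk_leaf_closed0 vS uS uv lv).
rewrite (wk_leaf_closed sg vS uS uv lv) (wk_leaf_closed sh vS' uS' uv' lv').
by apply: leq_conv => i ik //; apply: IH; lia.
Qed.

(** The increments due to the two leaves are compared; the additive form avoids subtraction in [nat]
    and telescopes. *)
Lemma leaf_trace_le k : irreflexive g ->
  (forall k, wk (res g (S :\ v)) k u u <= wk (res h (S' :\ v')) k u' u') ->
  trace_wk (res g S) k + trace_wk (res h (S' :\ v')) k <=
  trace_wk (res g (S :\ v)) k + trace_wk (res h S') k.
Proof.
move=> ig le; have lec := leaf_closed_le le.
have [vS uS uv lv] := vu; have [vS' uS' uv' lv'] := vu'.
case: k => [|[|k]]; first by rewrite !trace_wk0.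
  rewrite !(trace_wk1 _ ig) /trace_wk !add0n; apply: leq_sum => x _.
  by rewrite !wk1 /res !inE; case: (x == v'); case: (x \in S').
rewrite (trace_wk_leaf sg vS uS uv lv) (trace_wk_leaf sh vS' uS' uv' lv').
rewrite -addnA leq_add2l addnC leq_add2l leq_add //.
by apply: leq_conv => i _ //; rewrite leq_mul2l le orbT.
Qed.

(** All vertices are treated at once, since the next leaf may be attached anywhere. For [x != v],
    [conv_wk_le] trades walks between [x] and [u] for closed walks at both, which are bounded by
    those at [u']. *)
Lemma leaf_root_le : irreflexive g ->
  (forall k, {in S :\ v, forall x,
    wk (res g (S :\ v)) k x x <= wk (res h (S' :\ v')) k u' u'}) ->
  forall k, {in S, forall x, wk (res g S) k x x <= wk (res h S') k u' u'}.
Proof.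
move=> ig le; have [vS uS uv lv] := vu; have [vS' uS' uv' lv'] := vu'.
have leu k : wk (res g (S :\ v)) k u u <= wk (res h (S' :\ v')) k u' u'.
  by apply: le; rewrite !inE uv.
have lec := leaf_closed_le leu.
have rootE k := wk_nonleaf_closed sh vS' uS' lv' k uv'.
case=> [|[|k]] x xS; first by rewrite !wk0 !eqxx.
  by rewrite wk1_closed.
rewrite rootE; have [->|xv] := eqVneq x v.
  (* The recursion at the leaf has one factor counting closed walks at [u'] where that of [u'] has
     two; the empty walk makes the extra factor harmless. *)
  rewrite (leq_trans (lec _)) // (wk_leaf_closed sh vS' uS' uv' lv').
  apply: leq_trans (leq_addl _ _); apply: leq_conv => i _ //.
  by rewrite /conv big_ord_recr /= subnn wk0 eqxx muln1 leq_addl.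
have x' : x \in S :\ v by rewrite !inE xv.
rewrite (wk_nonleaf_closed sg vS uS lv k xv) leq_add ?le //.
apply: leq_conv => i _; last exact: lec.
apply: leq_trans (conv_wk_le _ _ _ (res_sym _ sg)) _.
by apply: leq_conv => j _; [apply: le | apply: leu].
Qed.
End LeafComparison.

(** * The triangle with pendant edges *)

(* Lower bounds for the numbers of walks of length [k] to the center of a
   triangle with a pendant edge, starting respectively at the center, at another
   vertex of the triangle and at the pendant vertex. *)
Definition paw_walks k :=
  iter k (fun p => (2 * p.1.2 + p.2, p.1.1 + p.1.2, p.1.1)) (1, 0, 0).

(** The recursion sends [(64, 48, 32)] to [(128, 112, 64)], at least its double; the values
    [(76, 76, 45)] at rank 7 start the induction. *)
Lemma paw_walks_ge k : [/\ 64 * 2 ^ k <= (paw_walks (k + 7)).1.1,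
  48 * 2 ^ k <= (paw_walks (k + 7)).1.2 & 32 * 2 ^ k <= (paw_walks (k + 7)).2].
Proof.
elim: k => [//|k]; rewrite addSn [paw_walks _.+1]iterS -/(paw_walks (k + 7)).
by case: (paw_walks (k + 7)) => [[w t] s] /= []; rewrite expnS; split; lia.
Qed.

Section Star.
Variable N : nat.
Let g0 := @Gamma3_adj N.+3.
(** [T 3] is the triangle and each further vertex is a leaf at [ord0], so the extremal graphs of all
    sizes up to [N.+3] live in one type. *)
Let T m := [set i : 'I_N.+3 | i < m].
Let sg : symmetric g0 := @Gamma3_adj_sym N.+3.
Let ig : irreflexive g0 := @Gamma3_adj_irrefl N.+3.
Let o1 : 'I_N.+3 := Ordinal (isT : 1 < N.+3).
Let o2 : 'I_N.+3 := Ordinal (isT : 2 < N.+3).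

Lemma star_leaf m (hm : m < N.+3) : 3 <= m ->
  is_leaf g0 (T m.+1) (Ordinal hm) ord0.
Proof.
move=> m3; split; rewrite ?inE //=; first by rewrite -(inj_eq val_inj) /=; lia.
by move=> y _; rewrite /g0 /Gamma3_adj /= -!(inj_eq val_inj) /=; lia.
Qed.

Lemma star_leafD m (hm : m < N.+3) : T m.+1 :\ Ordinal hm = T m.
Proof. by apply/setP => i; rewrite !inE -(inj_eq val_inj) /=; lia. Qed.

Lemma star_card3 : #|T 3| = 3.
Proof.
have -> : T 3 = [set ord0; o1; o2].
  apply/setP => i; rewrite !inE -!(inj_eq val_inj) /=; lia.
by rewrite setUC cardsU1 cards2 !inE.
Qed.

Lemma star_triangle : {in T 3 &, forall y z, g0 y z = (y != z)}.
Proof.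
move=> y z; rewrite !inE /g0 /Gamma3_adj => y3 z3.
by move: y3 z3; rewrite !ltnS => -> ->; rewrite !orbT andbT.
Qed.

Lemma star_trace3 k :
  trace_wk (res g0 (T 3)) k.+1 = 3 * (triangle_walks k.+1).1.
Proof.
rewrite trace_wk_in (eq_bigr (fun=> (triangle_walks k.+1).1)) => [|x xT].
  by rewrite sum_nat_const star_card3.
by rewrite (wk_triangle star_card3 star_triangle) // eqxx.
Qed.

Lemma star_root3 k : wk (res g0 (T 3)) k ord0 ord0 = (triangle_walks k).1.
Proof.
by rewrite (wk_triangle star_card3 star_triangle) ?inE // eqxx.
Qed.

Lemma star_root2 m : 3 <= m <= N.+3 -> wk (res g0 (T m)) 2 ord0 ord0 = m.-1.
Proof.
case/andP; elim: m => [//|m IH]; rewrite leq_eqVlt => /predU1P[<- _|].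
  by rewrite star_root3.
rewrite ltnS => m3 mN; have [vS uS uv lv] := star_leaf mN m3.
rewrite (wk_nonleaf_closed sg vS uS lv 0 uv) star_leafD IH ?(ltnW mN) //.
by rewrite /conv !big_ord1 !wk0 !eqxx /=; lia.
Qed.

Lemma star_trace2 m : 3 <= m <= N.+3 -> trace_wk (res g0 (T m)) 2 = 2 * m.
Proof.
case/andP; elim: m => [//|m IH]; rewrite leq_eqVlt => /predU1P[<- _|].
  by rewrite star_trace3.
rewrite ltnS => m3 mN; have [vS uS uv lv] := star_leaf mN m3.
rewrite (trace_wk_leaf sg vS uS uv lv) (wk_leaf_closed sg vS uS uv lv).
rewrite star_leafD IH ?(ltnW mN) //.
by rewrite /conv !big_ord1 !wk0 !eqxx /=; lia.
Qed.

Lemma star_trace3_ge m : 3 <= m <= N.+3 -> 6 <= trace_wk (res g0 (T m)) 3.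
Proof.
case/andP; elim: m => [//|m IH]; rewrite leq_eqVlt => /predU1P[<- _|].
  by rewrite star_trace3.
rewrite ltnS => m3 mN; have [vS uS uv lv] := star_leaf mN m3.
rewrite (trace_wk_leaf sg vS uS uv lv) star_leafD.
by apply: leq_trans (leq_addr _ _); rewrite IH ?(ltnW mN).
Qed.

Lemma star_trace4S m : 3 <= m -> m < N.+3 ->
  trace_wk (res g0 (T m.+1)) 4 = trace_wk (res g0 (T m)) 4 + 2 + 4 * m.-1.
Proof.
move=> m3 mN; rewrite (leaf_trace4 sg ig (star_leaf mN m3)) star_leafD.
by rewrite star_root2 // m3 ltnW.
Qed.

Lemma star_trace4 m : 3 <= m <= N.+3 ->
  trace_wk (res g0 (T m)) 4 + 4 * m = 2 * m ^ 2 + 12.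
Proof.
case/andP; elim: m => [//|m IH]; rewrite leq_eqVlt => /predU1P[<- _|].
  by rewrite star_trace3.
rewrite ltnS => m3 mN; have := IH m3 (ltnW mN).
by rewrite star_trace4S //; case: m m3 {IH mN} => // m _ /=; lia.
Qed.

Lemma star_paw m (hm : 3 < N.+3) : 3 < m ->
  forall k, let W x := wk (res g0 (T m)) k x ord0 in let p := paw_walks k in
  [/\ p.1.1 <= W ord0, p.1.2 <= W o1, p.1.2 <= W o2 & p.2 <= W (Ordinal hm)].
Proof.
move=> m3; elim=> [|k]; first by rewrite /= !wk0.
rewrite [paw_walks k.+1]iterS -/(paw_walks k).
case: (paw_walks k) => [[w t] s] /= [W0 W1 W2 W3]; rewrite !wkS.
have m2 : 2 < m by apply: ltnW.
have m1 : 1 < m by apply: ltnW.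
have m0 : 0 < m by apply: ltnW.
have rE (i j : 'I_N.+3) : i < m -> j < m -> res g0 (T m) i j = g0 i j.
  by move=> im jm; rewrite /res !inE im jm.
split.
- rewrite (bigD1 o1) ?rE //= (bigD1 o2) ?rE //= (bigD1 (Ordinal hm)) ?rE //=.
  by lia.
- by rewrite (bigD1 ord0) ?rE //= (bigD1 o2) ?rE //=; lia.
- by rewrite (bigD1 ord0) ?rE //= (bigD1 o1) ?rE //=; lia.
- by rewrite (bigD1 ord0) ?rE //=; lia.
Qed.

(** * Reduction to the cycle *)

Section Core.
Variables (V : finType) (g : rel V).
Hypotheses (sym_g : symmetric g) (irr_g : irreflexive g).

Lemma regular_card_gt2 (S : {set V}) :
  two_regular_on g S -> S != set0 -> 2 < #|S|.
Proof.
move=> rS /set0Pn[x xS]; have := rS x xS; rewrite wk2; last exact: res_sym.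
move=> c2; rewrite (cardsD1 x) xS ltnS -c2 subset_leq_card //.
apply/subsetP => y; rewrite !inE => /and3P[_ yS xy]; rewrite yS andbT.
by apply: contraTneq xy => ->; rewrite irr_g.
Qed.

Lemma regular_card3 (S : {set V}) : two_regular_on g S -> #|S| = 3 ->
  {in S &, forall y z, g y z = (y != z)}.
Proof.
move=> rS S3 x z xS zS; have := rS x xS; rewrite wk2; last exact: res_sym.
move=> c2; have cx : #|S :\ x| = 2.
  by move: S3; rewrite (cardsD1 x) xS add1n => -[].
have : [set y | res g S x y] == S :\ x.
  rewrite eqEcard c2 cx leqnn andbT.
  apply/subsetP => y; rewrite !inE => /and3P[_ yS xy]; rewrite yS andbT.
  by apply: contraTneq xy => ->; rewrite irr_g.
move/eqP/setP/(_ z); rewrite !inE /res xS zS andbT /= => ->.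
by rewrite eq_sym.
Qed.

Lemma regular_trace3 (S : {set V}) k : two_regular_on g S -> #|S| = 3 ->
  trace_wk (res g S) k.+1 = trace_wk (res g0 (T 3)) k.+1.
Proof.
move=> rS S3; rewrite star_trace3 trace_wk_in.
rewrite (eq_bigr (fun=> (triangle_walks k.+1).1)) => [|x xT].
  by rewrite sum_nat_const S3.
by rewrite (wk_triangle S3 (regular_card3 rS S3)) // eqxx.
Qed.

(** A triangle gives equality. A longer cycle is compared with [paw_walks]: lengths up to 6 one by
    one, where the odd ones need more than [regular_wk_le], then by growth. *)
Lemma regular_root_le (S : {set V}) k : two_regular_on g S -> uncut g S ->
  #|S| <= N.+3 ->
  {in S, forall x, wk (res g S) k x x <= wk (res g0 (T #|S|)) k ord0 ord0}.
Proof.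
move=> rS cS SN x xS; have S0 : S != set0 by apply/set0Pn; exists x.
have := regular_card_gt2 rS S0; rewrite leq_eqVlt => /predU1P[S3|S4].
  rewrite -S3 star_root3 (wk_triangle _ (regular_card3 rS _)) //.
  by rewrite eqxx.
have N3 : 3 < N.+3 by apply: leq_trans SN.
have [] := star_paw N3 S4 k; rewrite /= => + _ _ _; apply: leq_trans.
case: k => [|[|[|[|[|[|[|k]]]]]]].
- by rewrite wk0 eqxx.
- by rewrite wk1_closed.
- by rewrite rS.
- by rewrite regular_triangle_free // gtn_eqF.
- by apply: (@leq_trans 8) => //; exact: (regular_wk_le sym_g rS).
- by apply: (@leq_trans 8) => //; apply: regular_wk5 => //; rewrite gtn_eqF.
- by apply: (@leq_trans 32) => //; exact: (regular_wk_le sym_g rS).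
- have [+ _ _] := paw_walks_ge k; rewrite addnC; apply: leq_trans.
  by rewrite (leq_trans (regular_wk_le sym_g rS _ _ _)) // -[64]/(2 ^ 6) -expnD.
Qed.

(** Leaves are stripped in parallel with pendant vertices of the extremal graph. The bound at the
    root is carried along because each trace comparison uses it for the smaller graph. *)
Lemma unicyclic_core m (S : {set V}) : #|S| = m -> unicyclic_on g S ->
  m <= N.+3 ->
  [/\ 3 <= m,
   forall k, {in S, forall x,
     wk (res g S) k x x <= wk (res g0 (T m)) k ord0 ord0} &
   exists S0, [/\ unicyclic_on g S0, two_regular_on g S0, 3 <= #|S0| <= m &
     forall k, trace_wk (res g S) k + trace_wk (res g0 (T #|S0|)) k <=
       trace_wk (res g S0) k + trace_wk (res g0 (T m)) k]].
Proof.
elim: m S => [|m IH] S Sm uS mN.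
  by case: uS => + _ _; rewrite -cards_eq0 Sm.
have [[v [u vu]]|rS] := leaf_or_two_regular sym_g irr_g uS; last first.
  have S3 : 3 <= m.+1 by rewrite -Sm regular_card_gt2 //; case: uS.
  split=> // [k|].
    by rewrite -Sm; apply: regular_root_le; rewrite ?Sm //; case: uS.
  by exists S; rewrite Sm S3 leqnn.
have Sm' : #|S :\ v| = m.
  by case: vu => vS _ _ _; move: Sm; rewrite (cardsD1 v) vS add1n => -[].
have [m3 rle [S0 [uS0 rS0 S0m tle]]] :=
  IH _ Sm' (unicyclic_on_leaf sym_g vu uS) (ltnW mN).
have vT := star_leaf mN m3.
split; first exact: leqW.
- move=> k; apply: (leaf_root_le sym_g sg vu vT irr_g) => {}k x.
  by rewrite star_leafD; exact: rle.
- exists S0; split=> //; first by case/andP: S0m => -> /leqW->.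
  move=> k; have leu k' : wk (res g (S :\ v)) k' u u <=
      wk (res g0 (T m.+1 :\ Ordinal mN)) k' ord0 ord0.
    by rewrite star_leafD; apply: rle; case: vu => _ uS' uv _; rewrite !inE uv.
  have := leaf_trace_le sym_g sg vu vT k irr_g leu; rewrite star_leafD.
  by have := tle k; lia.
Qed.

End Core.
End Star.

Lemma eq_trace_wk (V : finType) (a b : rel V) :
  a =2 b -> forall k, trace_wk a k = trace_wk b k.
Proof. by move=> ab k; apply: eq_bigr => x _; exact: eq_wk. Qed.

(* For the cycle of length [m > 3], the closed walks of length 3, 4 and [k + 5]
   number 0, at most [8 * m] and at most [m * 2 ^ (k + 4)], against at least 6,
   exactly [2 * m ^ 2 - 4 * m + 12] and at least 0 in the triangle with [m - 3]
   pendant edges. *)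
Definition trace_gap (G H : nat -> nat) (m : nat) : Prop :=
  [/\ forall k, k <= 2 -> G k <= H k, G 3 + 6 <= H 3,
    G 4 + (2 * m ^ 2 + 12) <= H 4 + 12 * m &
    forall k, G (k + 5) <= H (k + 5) + m * 2 ^ (k + 4)].

(** One leaf is removed before [unicyclic_core] is applied, so that its neighbour [u] is at hand in
    the equality case. A graph without leaves is a cycle of length above 3. *)
Lemma unicyclic_trace_le (V : finType) (g : rel V) (n : nat) :
  symmetric g -> irreflexive g -> unicyclic_on g setT ->
  3 < n -> #|V| = n ->
  let G := trace_wk g in let H := trace_wk (@Gamma3_adj n) in
  ((forall k, G k <= H k) /\
     (G 4 = H 4 -> exists u, forall y, g u y = (y != u))) \/
  exists m, trace_gap G H m.
Proof.
case: n => [|[|[|N]]] // sg ig uV N4 Vn G H.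
pose T m := [set i : 'I_N.+3 | i < m].
have GE k : G k = trace_wk (res g setT) k.
  by apply: eq_trace_wk => x y; rewrite resT.
have HE k : H k = trace_wk (res (@Gamma3_adj N.+3) (T N.+3)) k.
  by apply: eq_trace_wk => x y; rewrite /res !inE !ltn_ord.
have VT : #|[set: V]| = N.+3 by rewrite cardsT.
have large_core S0 : unicyclic_on g S0 -> two_regular_on g S0 ->
    3 < #|S0| <= N.+3 ->
    (forall k, G k + trace_wk (res (@Gamma3_adj N.+3) (T #|S0|)) k <=
       trace_wk (res g S0) k + H k) ->
  exists m, trace_gap G H m.
  move=> [_ cS0 tS0] rS0 /andP[S04 S0n] tle; exists #|S0|.
  have S0N : 2 < #|S0| <= N.+3 by rewrite S0n ltnW.
  have S0n3 : #|S0| != 3 by rewrite gtn_eqF.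
  have tr k : trace_wk (res g S0) k.+1 <= #|S0| * 2 ^ k.
    exact: regular_trace_le.
  split=> [[|[|[|//]]] _||| k].
  - by rewrite /G /H !trace_wk0 Vn card_ord.
  - by rewrite GE trace_wk1.
  - by have := tle 2; rewrite tS0 star_trace2 //; lia.
  - have := tle 3; rewrite [X in _ <= X + _](_ : _ = 0); last first.
      by rewrite /trace_wk big1 // => x _; apply: regular_triangle_free.
    by have := star_trace3_ge S0N; rewrite -/(T _); lia.
  - have := tle 4; have := tr 3; have := star_trace4 S0N.
    by rewrite -/(T _); lia.
  - have := tle (k + 5); have := tr (k + 4).
    by rewrite -addnS; lia.
have [[v [u vu]]|rV] := leaf_or_two_regular sg ig uV; last first.
  right; apply: (large_core setT) => // [|k]; first by rewrite VT N4 leqnn.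
  by rewrite VT -HE -GE leqnn.
have [_ _ uv lv] := vu.
have Vv : #|[set: V] :\ v| = N.+2.
  by move: VT; rewrite (cardsD1 v) inE add1n => -[].
have [n3 rle [S0 [uS0 rS0 /andP[S03 S0n] tle]]] :=
  unicyclic_core sg ig Vv (unicyclic_on_leaf sg vu uV) (leqnSn _).
rewrite -!/(T _) in tle rle.
have vT := star_leaf (ltnSn N.+2) n3.
have uT : u \in [set: V] :\ v by rewrite !inE uv.
have step k : G k + trace_wk (res (@Gamma3_adj N.+3) (T N.+2)) k <=
    trace_wk (res g (setT :\ v)) k + H k.
  rewrite GE HE.
  have := leaf_trace_le sg (@Gamma3_adj_sym _) vu vT k ig.
  by rewrite star_leafD; apply=> k'; exact: rle.
move: S03; rewrite leq_eqVlt => /predU1P[/esym S03|S04];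
  [left|right]; last first.
  apply: (large_core S0) => // [|k]; first by rewrite S04 leqW.
  by have := step k; have := tle k; lia.
have GH k : trace_wk (res g (setT :\ v)) k <=
    trace_wk (res (@Gamma3_adj N.+3) (T N.+2)) k.
  case: k => [|k]; first by rewrite !trace_wk0 Vn card_ord.
  have := tle k.+1; rewrite (regular_trace3 N sg ig k rS0 S03) S03.
  by rewrite -/(T _); lia.
split=> [k|G4]; first by have := step k; have := GH k; lia.
exists u => y.
have sr := res_sym ([set: V] :\ v) sg.
(* Equal fourth moments and [GH 4] give [u] at least [N.+1] neighbours besides [v], which is all the
   other vertices. *)
have : N.+1 <= #|[set y | res g (setT :\ v) u y]|.
  move: G4; rewrite GE HE (leaf_trace4 sg ig vu) (star_trace4S n3 (ltnSn _)).
  by rewrite wk2 // -/(T _); have := GH 4; lia.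
have : [set y | res g (setT :\ v) u y] \subset setT :\ v :\ u.
  apply/subsetP => z; rewrite !inE => /and3P[_]; rewrite !inE !andbT => -> uz.
  by rewrite andbT; apply: contraTneq uz => ->; rewrite ig.
have cu : #|[set: V] :\ v :\ u| = N.+1.
  by move: Vv; rewrite (cardsD1 u) uT add1n => -[].
move=> sub; rewrite -cu => /(conj sub)/andP.
rewrite -eqEcard => /eqP/setP/(_ y).
rewrite /res !inE uv !andbT /=.
have [->|yv] := eqVneq y v; last by rewrite andbT.
by move=> _; rewrite sg lv ?inE // eqxx eq_sym uv.
Qed.

(** * Edges of a unicyclic graph *)

Section SignedGraphs.
Variable V : finType.
Implicit Types (G : graph V) (S : signed_graph V) (u x y : V) (Z : {set V}).

Lemma eq_set2 x y u v : x != y ->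
  ([set x; y] == [set u; v]) = (x == u) && (y == v) || (x == v) && (y == u).
Proof.
move=> xy.
apply/eqP/orP => [/setP E|[]/andP[/eqP-> /eqP->] //]; last exact: setUC.
move: xy (E x) (E y); rewrite !inE !eqxx !orbT.
move=> + /esym/orP[]/eqP xE /esym/orP[]/eqP yE; rewrite xE yE ?eqxx // => _.
  by left.
by right.
Qed.

Lemma mem_edges G x y : ([set x; y] \in edges G) = adj G x y.
Proof.
apply/imsetP/idP => [[[u v]]|xy]; last by exists (x, y); rewrite ?inE.
rewrite inE /= => uv E.
have : u != v by apply: contraTneq uv => ->; rewrite adj_irrefl.
move/(eq_set2 x y); rewrite E eqxx => /esym/orP[]/andP[/eqP<- /eqP<-] //.
by rewrite adj_sym.
Qed.

Lemma edgesP G e :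
  reflect (exists x y, [/\ e = [set x; y], x != y & adj G x y]) (e \in edges G).
Proof.
apply: (iffP imsetP) => [[[x y]]|[x [y [-> _ xy]]]].
  rewrite inE /= => xy ->; exists x, y; split=> //.
  by apply: contraTneq xy => ->; rewrite adj_irrefl.
by exists (x, y); rewrite ?inE.
Qed.

Lemma handshake G : trace_wk (adj G) 2 = 2 * #|edges G|.
Proof.
rewrite /trace_wk (eq_bigr _ (fun x _ => wk2 x (adj_sym G))).
under eq_bigr do rewrite -sum1dep_card.
rewrite pair_big_dep /=.
pose edge (p : V * V) := [set p.1; p.2].
rewrite (partition_big edge (mem (edges G))) /=; last first.
  by move=> p pE; rewrite mem_edges.
rewrite mulnC -sum_nat_const; apply: eq_bigr => e /edgesP[x [y [-> xy gxy]]].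
rewrite sum1dep_card (_ : [set _ | _] = [set (x, y); (y, x)]).
  by rewrite cards2 xpair_eqE (negbTE xy).
apply/setP => -[u v]; rewrite !inE !xpair_eqE /edge /=.
apply/andP/orP => [[uv]|].
  rewrite eq_set2; last by apply: contraTneq uv => ->; rewrite adj_irrefl.
  by case/orP; [left|right].
by case=> /andP[/eqP-> /eqP->]; rewrite ?eqxx // adj_sym gxy setUC eqxx.
Qed.

Lemma connected_uncut G : Defs.connected G -> uncut (adj G) setT.
Proof.
move=> [_ conn] B _ /set0Pn[x xB]; rewrite -properT => /properP[_ [y _ yB]].
have [/existsP[p /andP[pB /existsP[q /andP[qB pq]]]]|N] :=
    boolP [exists p, (p \in B) && [exists q, (q \notin B) && adj G p q]].
  by exists p, q; rewrite inE.
have cl p q : adj G p q -> p \in B -> q \in B.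
  move=> pq pB; apply: contraNT N => qB; apply/existsP; exists p; rewrite pB.
  by apply/existsP; exists q; rewrite qB.
have clB : closed (adj G) (mem B).
  by move=> p q pq; apply/idP/idP; apply: cl; rewrite // adj_sym.
by move: yB; rewrite -[y \in B](closed_connect clB (conn x y)) xB.
Qed.

Lemma unicyclic_on_setT G : unicyclic G -> unicyclic_on (adj G) setT.
Proof.
move=> [cG eG]; split; [|exact: connected_uncut|].
  by case: cG => + _; rewrite -cardsT card_gt0.
by rewrite (eq_trace_wk (@resT _ _)) handshake eG cardsT.
Qed.

Lemma card_set2I x y Z : x != y ->
  (#|[set x; y] :&: Z| == 1) = (x \in Z) (+) (y \in Z).
Proof.
move=> xy; have [xZ|xZ] := boolP (x \in Z); have [yZ|yZ] := boolP (y \in Z).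
- by rewrite (setIidPl _) ?cards2 ?xy // subUset !sub1set xZ yZ.
- rewrite (_ : _ :&: _ = [set x]) ?cards1 //; apply/setP => z; rewrite !inE.
  have [->|] := eqVneq z x; first by rewrite xZ.
  by have [->|] := eqVneq z y; rewrite ?(negbTE yZ).
- rewrite (_ : _ :&: _ = [set y]) ?cards1 //; apply/setP => z; rewrite !inE.
  have [->|] := eqVneq z y; first by rewrite yZ orbT.
  by have [->|] := eqVneq z x; rewrite ?(negbTE xZ).
- rewrite (_ : _ :&: _ = set0) ?cards0 //; apply/setP => z; rewrite !inE.
  have [->|] := eqVneq z y; first by rewrite (negbTE yZ) andbF.
  by rewrite orbF; have [->|] := eqVneq z x; rewrite ?(negbTE xZ).
Qed.

(** The edges at [u] number one less than the vertices, so exactly one edge avoids [u]. *)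
Lemma unicyclic_universal G u :
  unicyclic G -> (forall y, adj G u y = (y != u)) ->
  exists p q, [/\ u != p, u != q, p != q &
    forall x y, x != u -> y != u -> adj G x y = ([set x; y] == [set p; q])].
Proof.
move=> [_ eG] uG.
pose E := [set [set u; y] | y in [set~ u]].
have EG : E \subset edges G.
  by apply/subsetP => _ /imsetP[y + ->]; rewrite mem_edges uG !inE.
have cE : #|E|.+1 = #|edges G|.
  rewrite eG card_in_imset ?cardsC1 ?prednK //.
    by apply/card_gt0P; exists u.
  move=> y z; rewrite !inE => yu zu /eqP; rewrite eq_set2 1?eq_sym // eqxx /=.
  by rewrite [u == z]eq_sym (negbTE zu) orbF => /eqP.
have /cards1P[e eE] : #|edges G :\: E| == 1.
  by rewrite cardsD (setIidPr EG) -cE subSnn.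
have out x y : x != u -> y != u -> [set x; y] \notin E.
  move=> xu yu; apply/imsetP => -[z _ /setP/(_ u)]; rewrite !inE eqxx /=.
  by rewrite ![u == _]eq_sym (negbTE xu) (negbTE yu).
have eG' : e \in edges G :\: E by rewrite eE inE.
have /edgesP[p [q [epq pq gpq]]] : e \in edges G.
  by move: eG'; rewrite inE => /andP[].
have [up uq] : u != p /\ u != q.
  move: eG'; rewrite inE epq => /andP[nE _]; split; apply: contraNneq nE => uE.
    by apply/imsetP; exists q; rewrite -?uE // !inE uE eq_sym.
  by apply/imsetP; exists p; rewrite -?uE 1?setUC // !inE uE.
exists p, q; split=> // x y xu yu; rewrite -epq -in_set1 -eE inE mem_edges.
by rewrite out.
Qed.

End SignedGraphs.

Import Order.TTheory GRing.Theory Num.Theory.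
Import numFieldNormedType.Exports.
Local Open Scope ring_scope.

(** * Moments and the Estrada index *)

Lemma conj_diag_exp (F : comUnitRingType) n (P : 'M[F]_n) (d : 'rV_n) k :
  P \in unitmx -> (invmx P *m diag_mx d *m P) ^+ k =
    invmx P *m diag_mx (map_mx (fun z => z ^+ k) d) *m P.
Proof.
move=> Pu; elim: k => [|k IH].
  rewrite expr0 (_ : diag_mx _ = 1%:M) ?mulmx1 ?mulVmx //.
  by apply/matrixP => i j; rewrite !mxE expr0.
rewrite exprSr IH -[_ * _]/(_ *m _) !mulmxA mulmxK //.
congr (_ *m _); rewrite -mulmxA mulmx_diag; congr (_ *m diag_mx _).
by apply/rowP => i; rewrite !mxE exprSr.
Qed.

(** Over the complex numbers [A] is Hermitian, hence diagonalizable. The diagonal and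
    [eigenvalues A] are the roots of one characteristic polynomial, so they agree up to order. *)
Lemma sum_eigenvalues_exp (R : rcfType) n (A : 'M[R]_n) k : A^T = A ->
  \sum_(mu <- eigenvalues A) mu ^+ k = \tr (A ^+ k).
Proof.
move=> Asym.
pose B := map_mx (real_complex R) A.
have Bherm : B \is hermsymmx.
  apply: realsym_hermsym.
    apply/is_hermitianmxP; rewrite expr0 scale1r.
    by apply/matrixP=> i j; rewrite !mxE -{1}Asym mxE.
  by apply/mxOverP => i j; rewrite mxE complex_real.
have [P [d [Pu BE]]] : exists P d,
    P \in unitmx /\ B = invmx P *m diag_mx d *m P.
  exists (spectralmx B), (spectral_diag B); split; first exact: spectral_unit.
  exact/orthomx_spectralP/hermitian_normalmx.
have BkE : B ^+ k = invmx P *m diag_mx (map_mx (fun z => z ^+ k) d) *m P.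
  by rewrite {1}BE conj_diag_exp.
have trB : \tr (B ^+ k) = \sum_i d 0 i ^+ k.
  rewrite BkE mxtrace_mulC mulmxA mulmxV // mul1mx mxtrace_diag.
  by apply: eq_bigr => i _; rewrite mxE.
have charB : char_poly B =
    \prod_(z <- [seq d 0 i | i <- enum 'I_n]) ('X - z%:P).
  rewrite /char_poly; pose M := map_mx (@polyC R[i]) : 'M_n -> 'M_n.
  have MP : M P \in unitmx by rewrite map_unitmx.
  have -> : char_poly_mx B = invmx (M P) *m char_poly_mx (diag_mx d) *m M P.
    rewrite /char_poly_mx {1}BE !map_mxM map_invmx -/(M P).
    rewrite mulmxBr mulmxBl; congr (_ - _).
    by rewrite scalar_mxC -mulmxA mulVmx // mulmx1.
  rewrite !det_mulmx mulrAC -det_mulmx mulVmx // det1 mul1r -/(char_poly _).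
  rewrite char_poly_trig ?diag_mx_is_trig // big_map big_enum.
  by apply: eq_bigr => i _; rewrite mxE eqxx mulr1n.
have : char_poly B = \prod_(z <- [seq real_complex R mu | mu <- eigenvalues A])
    ('X - z%:P).
  rewrite -map_char_poly (char_poly_eigenvalues Asym) rmorph_prod big_map.
  by apply: eq_bigr => mu _; rewrite rmorphB /= map_polyX map_polyC.
rewrite charB => /prod_XsubC_eq ds.
have BkA : map_mx (real_complex R) (A ^+ k) = B ^+ k.
  by elim: k {BkE trB} => [|k IH]; rewrite ?map_mx1 // !exprSr map_mxM IH.
apply: (fmorph_inj (real_complex R)).
rewrite rmorph_sum -[RHS]trace_map_mx BkA trB.
rewrite -[RHS]big_enum -[RHS](big_map _ predT (fun z => z ^+ k)).
rewrite [RHS](perm_big _ ds).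
by rewrite big_map; apply: eq_bigr => mu _; rewrite rmorphXn.
Qed.

Section Expansion.
Variable R : realType.

Definition trace_exp_sum n (A : 'M[R]_n) (K : nat) : R :=
  \sum_(0 <= k < K) \tr (A ^+ k) / k`!%:R.

Lemma EE_cvg (V : finType) (S : signed_graph V) :
  (trace_exp_sum (adjacency R S) @ \oo --> EE R S)%classic.
Proof.
rewrite /EE; set s := eigenvalues _.
rewrite (_ : trace_exp_sum _ =
    fun K => \sum_(mu <- s) series (exp_coeff mu) K).
  apply: cvg_big => [|mu _]; first exact: add_continuous.
  exact: is_cvg_series_exp_coeff.
apply/funext => K; rewrite /trace_exp_sum /series /= exchange_big /=.
apply: eq_bigr => k _; rewrite -sum_eigenvalues_exp ?adjacency_sym //.
by rewrite big_distrl.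
Qed.
End Expansion.

Section SignedWalks.
Variables (R : comPzRingType) (V : finType).
Implicit Types (c : V -> V -> R).

Fixpoint signed_wk c k x y : R :=
  if k is k'.+1 then \sum_z c x z * signed_wk c k' z y else (x == y)%:R.

(** The adjacency matrix indexed by vertices, free of the enumeration of [V]. *)
Definition weight (S : signed_graph V) x y : R :=
  if adj S x y then edge_sign R S [set x; y]%SET else 0.

Lemma adjacency_exp (S : signed_graph V) k i j :
  (adjacency R S ^+ k) i j = signed_wk (weight S) k (enum_val i) (enum_val j).
Proof.
elim: k i => [|k IH] i; first by rewrite expr0 mxE /= (inj_eq enum_val_inj).
rewrite exprS mxE /= [RHS](big_enum_val _).
by apply: eq_bigr => l _; rewrite IH mxE.
Qed.

Lemma trace_adjacency_exp (S : signed_graph V) k :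
  \tr (adjacency R S ^+ k) = \sum_x signed_wk (weight S) k x x.
Proof.
by rewrite [RHS](big_enum_val _); apply: eq_bigr => i _; rewrite adjacency_exp.
Qed.
End SignedWalks.

Section SignedUnsigned.
Variables (R : realType) (V : finType) (c : V -> V -> R) (a : rel V).

Lemma natr_wkS k x y :
  (wk a k.+1 x y)%:R = \sum_z (a x z)%:R * (wk a k z y)%:R :> R.
Proof.
rewrite wkS natr_sum big_mkcond; apply: eq_bigr => z _.
by case: (a x z); rewrite ?mul1r ?mul0r.
Qed.

Lemma signed_wk_norm_le : (forall x y, `|c x y| <= (a x y)%:R) ->
  forall k x y, `|signed_wk c k x y| <= (wk a k x y)%:R.
Proof.
move=> ca; elim=> [|k IH] x y; first by rewrite /= wk0 normr_nat.
rewrite natr_wkS (le_trans (ler_norm_sum _ _ _)) // ler_sum // => z _.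
by rewrite normrM ler_pM.
Qed.

Lemma signed_wk_unsigned : (forall x y, c x y = (a x y)%:R) ->
  forall k x y, signed_wk c k x y = (wk a k x y)%:R.
Proof.
move=> ca; elim=> [|k IH] x y; first by rewrite /= wk0.
by rewrite natr_wkS /=; apply: eq_bigr => z _; rewrite ca IH.
Qed.

Lemma signed_trace_le k : (forall x y, `|c x y| <= (a x y)%:R) ->
  \sum_x signed_wk c k x x <= (trace_wk a k)%:R.
Proof.
move=> ca; rewrite /trace_wk natr_sum ler_sum // => x _.
exact: le_trans (ler_norm _) (signed_wk_norm_le ca k x x).
Qed.

Lemma signed_wk3 x : signed_wk c 3 x x = \sum_y \sum_z c x y * c y z * c z x.
Proof.
rewrite /=; apply: eq_bigr => y _; rewrite big_distrr; apply: eq_bigr => z _.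
rewrite -mulrA; congr (_ * (_ * _)).
rewrite (bigD1 x) //= eqxx mulr1 big1 ?addr0 // => t.
by move=> /negbTE ->; rewrite mulr0.
Qed.

End SignedUnsigned.

(** The deficit is a sum of nonnegative terms [D] over triples, so equality makes each of them
    vanish. *)
Lemma signed_trace3_eq (R : realType) (V : finType) (c : V -> V -> R)
    (a : rel V) :
  (forall x y, `|c x y| <= (a x y)%:R) ->
  \sum_x signed_wk c 3 x x = (trace_wk a 3)%:R ->
  forall x y z, a x y -> a y z -> a z x -> c x y * c y z * c z x = 1.
Proof.
move=> ca trE x y z xy yz zx.
pose b u v : R := (a u v)%:R.
have trE' : (trace_wk a 3)%:R = \sum_x signed_wk b 3 x x.
  rewrite /trace_wk natr_sum; apply: eq_bigr => t _.
  by rewrite (@signed_wk_unsigned _ _ b a).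
pose D u v w := b u v * b v w * b w u - c u v * c v w * c w u.
have D0 u v w : 0 <= D u v w.
  rewrite subr_ge0 (le_trans (ler_norm _)) // !normrM.
  by rewrite !ler_pM ?mulr_ge0 //; exact: ca.
have : \sum_u \sum_v \sum_w D u v w = 0.
  under eq_bigr do under eq_bigr do rewrite sumrB.
  under eq_bigr do rewrite sumrB -!signed_wk3.
  by rewrite sumrB -trE' -trE subrr.
have S0 u v : 0 <= \sum_w D u v w by apply: sumr_ge0.
move/psumr_eq0P => /(_ (fun u _ => sumr_ge0 _ (fun v _ => S0 u v)))/(_ x isT).
move/psumr_eq0P => /(_ (fun v _ => S0 x v))/(_ y isT).
move/psumr_eq0P => /(_ (fun w _ => D0 x y w))/(_ z isT).
by rewrite /D /b xy yz zx !mulr1 => /eqP; rewrite subr_eq0 => /eqP.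
Qed.

(** * Comparison of exponential series *)

Section Limits.
Variables (R : realType) (u v : nat -> R) (l l' : R).
Hypotheses
  (ul : ((fun K => \sum_(0 <= k < K) u k / k`!%:R) @ \oo --> l)%classic)
  (vl : ((fun K => \sum_(0 <= k < K) v k / k`!%:R) @ \oo --> l')%classic).

Lemma exp_series_le_gap (c : R) (K0 : nat) :
  (forall K, \sum_(0 <= k < K + K0) (u k - v k) / k`!%:R <= c) -> l - l' <= c.
Proof.
move=> le.
have uv : ((fun K => \sum_(0 <= k < K) (u k - v k) / k`!%:R) @ \oo -->
    l - l')%classic.
  rewrite (_ : (fun K => _) = (fun K => \sum_(0 <= k < K) u k / k`!%:R) \-
     (fun K => \sum_(0 <= k < K) v k / k`!%:R)); first exact: cvgB.
  apply/funext => K /=; rewrite -sumrB; apply: eq_bigr => k _.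
  by rewrite mulrBl.
rewrite -(cvg_lim _ uv) //; apply: limr_le.
  by apply/cvg_ex; exists (l - l').
by exists K0 => // K /= K0K; rewrite -(subnK K0K).
Qed.

Let term_le0 k : u k <= v k -> (u k - v k) / k`!%:R <= 0.
Proof. by move=> uv; rewrite mulr_le0_ge0 ?subr_le0 ?invr_ge0 ?ler0n. Qed.

Lemma exp_series_le : (forall k, u k <= v k) -> l <= l'.
Proof.
move=> uv; rewrite -subr_le0; apply: (@exp_series_le_gap 0 0) => K.
by apply: sumr_le0 => k _; exact: term_le0.
Qed.

(** A strict inequality at [k] would keep all later partial sums of the difference below one
    negative number, and so the limit. *)
Lemma exp_series_eq : (forall k, u k <= v k) -> l = l' -> forall k, u k = v k.
Proof.
move=> uv ll' k; apply/eqP; rewrite eq_le uv leNgt; apply/negP => uvk.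
suff : l - l' <= (u k - v k) / k`!%:R.
  apply/negP; rewrite ll' subrr -ltNge pmulr_llt0 ?subr_lt0 //.
  by rewrite invr_gt0 ltr0n fact_gt0.
apply: (@exp_series_le_gap _ k.+1) => K.
rewrite (big_cat_nat (n := k.+1)) ?leq_addl //= big_nat_recr //=.
have sum_le0 r : \sum_(i <- r) (u i - v i) / i`!%:R <= 0.
  by apply: sumr_le0 => i _; exact: term_le0.
by rewrite -lerBrDl (le_trans (sum_le0 _)) // subr_ge0 gerDr.
Qed.

End Limits.

(** The first term is [16 / 120 = 2 / 15] and the ratios [2 / (j + 6)] are at most [1 / 3], so a
    geometric series of sum [1 / 5] dominates. *)
Lemma exp_tail_le (R : realFieldType) J :
  \sum_(0 <= j < J) (2 ^ (j + 4))%:R / (j + 5)`!%:R <= 1 / 5 :> R.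
Proof.
have tE j : (2 ^ (j + 4))%:R / (j + 5)`!%:R <= 2 / 15 * (1 / 3) ^+ j :> R.
  elim: j => [|j IH]; first by rewrite expr0 !factS fact0; lra.
  rewrite !addSn expnS factS !natrM exprSr -mulf_div.
  rewrite [leRHS]mulrA [leRHS]mulrC ler_pM ?divr_ge0 ?ler0n //.
  by rewrite ler_pdivrMr ?ltr0n // -addnS natrD; have := ler0n R j; lra.
have geo : \sum_(0 <= j < J) (2 / 15 * (1 / 3) ^+ j) =
    1 / 5 * (1 - (1 / 3) ^+ J) :> R.
  elim: J => [|J IH]; first by rewrite big_nil expr0; lra.
  by rewrite big_nat_recr //= IH exprSr; field.
apply: (@le_trans _ _ (\sum_(0 <= j < J) (2 / 15 * (1 / 3) ^+ j))).
  by apply: ler_sum => j _; exact: tE.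
have : 0 <= (1 / 3) ^+ J :> R by apply: exprn_ge0; lra.
by rewrite geo; lra.
Qed.

(** * Switching *)

Lemma imset_set2 (V W : finType) (f : V -> W) x y :
  f @: [set x; y] = [set f x; f y].
Proof. by rewrite imsetU1 imset_set1. Qed.

Lemma adj_neq (V : finType) (G : graph V) x y : adj G x y -> x != y.
Proof. by apply: contraTneq => ->; rewrite adj_irrefl. Qed.

Lemma weight_norm (R : realType) (V : finType) (S : signed_graph V) x y :
  `|weight R S x y| <= (adj S x y)%:R.
Proof.
by rewrite /weight; case: (adj S x y); rewrite ?normr0 // normr_sign.
Qed.

(** Switching conjugates the weights by the diagonal signs [s], which cancel on closed walks. *)
Lemma switching_equivalent_trace (R : realType) (V W : finType)
    (S : signed_graph V) (T : signed_graph W) k : switching_equivalent S T ->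
  \sum_x signed_wk (weight R S) k x x = \sum_w signed_wk (weight R T) k w w.
Proof.
case=> Z [f [bf adjf negf]].
pose s x : R := (-1) ^+ (x \in Z).
have ss x : s x * s x = 1 by rewrite -expr2 sqrr_sign.
have wE x y : weight R T (f x) (f y) = s x * weight R S x y * s y.
  rewrite /weight adjf /=; case: ifP => [xy|]; last by rewrite mulr0 mul0r.
  rewrite /edge_sign -imset_set2 negf ?mem_edges //=.
  by rewrite card_set2I ?(adj_neq xy) // !signr_addb mulrC mulrAC.
have wkE x y : signed_wk (weight R T) k (f x) (f y) =
    s x * signed_wk (weight R S) k x y * s y.
  elim: k x => [|k IH] x /=.
    rewrite (inj_eq (bij_inj bf)); have [->|] := eqVneq x y.
      by rewrite mulr1 ss.
    by rewrite mulr0 mul0r.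
  rewrite (reindex f) /=; last exact: onW_bij.
  rewrite big_distrr big_distrl; apply: eq_bigr => z _ /=.
  by rewrite wE IH mulrA -!mulrA (mulrA (s z)) ss mul1r.
rewrite [RHS](reindex f) /=; last exact: onW_bij.
by apply: eq_bigr => x _; rewrite wkE mulrAC ss mul1r.
Qed.

(** Switching at [Z] makes every edge at [u] positive. The only other edge closes a triangle with
    [u], whose sign is unchanged. *)
Lemma universal_switching (V : finType) (S : signed_graph V) (u : V) :
  unicyclic S -> (forall y, adj S u y = (y != u)) ->
  (forall x y z, adj S x y -> adj S y z -> adj S z x ->
     negative S [set x; y] (+) negative S [set y; z] (+) negative S [set z; x]
     = false) ->
  (2 < #|V|)%N -> switching_equivalent S (Gamma3_plus #|V|).
Proof.
move=> uS adju tri V3.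
have [p [q [up uq pq adjE]]] := unicyclic_universal uS adju.
pose Z := [set y | (y != u) && negative S [set u; y]].
exists Z.
(* Listing [u], [p], [q] first gives them the indices 0, 1, 2 of the triangle. *)
pose r := [seq x <- enum V | [&& x != u, x != p & x != q]].
pose s := [:: u, p, q & r].
have us : uniq s.
  rewrite /= !inE !mem_filter !eqxx /= ?andbF !negb_or up uq pq /=.
  by rewrite filter_uniq // enum_uniq.
have sV x : x \in s.
  rewrite !inE mem_filter mem_enum andbT.
  by case: (x == u); case: (x == p); case: (x == q).
have ss : size s = #|V|.
  by rewrite -(card_uniqP us); apply: eq_card => x; rewrite sV.
have lt x : (index x s < #|V|)%N by rewrite -ss index_mem.
pose f x := Ordinal (lt x).
have fI : injective f.
  by move=> x y [/(congr1 (nth u s))]; rewrite !nth_index.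
have f0 x : (f x == 0 :> nat)%N = (x == u).
  by rewrite /= [x == u]eq_sym; case: (u == x).
have f2 x : (f x <= 2)%N = [|| x == u, x == p | x == q].
  by rewrite /= ![x == _]eq_sym; case: (u == x); case: (p == x); case: (q == x).
exists f; split.
- by apply: inj_card_bij => //; rewrite card_ord.
- move=> x y; rewrite /= /Gamma3_adj (inj_eq fI) f0 f0 !f2.
  have [->|xy] := eqVneq x y; first by rewrite adj_irrefl.
  have [xE|xu] /= := eqVneq x u; first by rewrite xE adju -xE eq_sym xy.
  have [->|yu] /= := eqVneq y u; first by rewrite adj_sym adju xu.
  rewrite adjE // eq_set2 //; move: xy.
  have [->|xp] := eqVneq x p => /=.
    by rewrite eq_sym (negbTE pq) orbF => /negbTE->.
  have [->|xq] //= := eqVneq x q.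
  by rewrite eq_sym => /negbTE->; rewrite orbF.
move=> e /edgesP[x [y [-> xy axy]]] /=; rewrite card_set2I //.
have negZ z : (z \in Z) = (z != u) && negative S [set u; z] by rewrite inE.
rewrite !negZ; have [xE|xu] := eqVneq x u.
  by rewrite xE /= eq_sym -xE xy /= addbb.
have [yE|yu] := eqVneq y u; first by rewrite yE /= addbF setUC addbb.
apply/esym; rewrite -[RHS](tri u x y) ?adju ?xu ?axy // 1?adj_sym ?adju ?yu //.
by rewrite [[set y; u]]setUC; do 3!case: (negative S _).
Qed.

(** The terms add up to at most [- 1 + (12 m - 2 m^2 - 12) / 24 + m / 5], that is,
    [- m^2 / 12 + 7 m / 10 - 3 / 2]. The maximum over real [m], at [42 / 10], is [- 3 / 100]. *)
Lemma partial_sum_gap (R : realType) (u : nat -> R) (G H : nat -> nat) m J :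
  (forall k, u k <= (G k)%:R) ->
  trace_gap G H m ->
  \sum_(0 <= k < J + 5) (u k - (H k)%:R) / k`!%:R <= - (3 / 100).
Proof.
move=> uG [GH2 GH3 GH4 GH5].
have le k (d : R) : (G k)%:R <= (H k)%:R + d ->
    (u k - (H k)%:R) / k`!%:R <= d / k`!%:R.
  move=> GHd; rewrite ler_wpM2r ?invr_ge0 ?ler0n //.
  by have := uG k; lra.
rewrite (big_cat_nat (n := 5)) ?leq_addl //=.
have tail : \sum_(5 <= k < J + 5) (u k - (H k)%:R) / k`!%:R <= m%:R / 5.
  rewrite -{1}[5%N]add0n big_addn addnK.
  apply: (@le_trans _ _ (\sum_(0 <= j < J)
      m%:R * ((2 ^ (j + 4))%:R / (j + 5)`!%:R))).
    apply: ler_sum => j _; rewrite mulrA; apply: le.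
    by rewrite -natrM -natrD ler_nat.
  rewrite -big_distrr /= ler_wpM2l ?ler0n // -[_^-1]mul1r.
  exact: exp_tail_le.
have le0 k : (k <= 2)%N -> (u k - (H k)%:R) / k`!%:R <= 0.
  move=> k2; rewrite -[leRHS](mul0r (k`!%:R^-1)); apply: le.
  by rewrite addr0 ler_nat GH2.
have le3 : (u 3 - (H 3)%:R) / 3`!%:R <= - 6 / 3`!%:R.
  by apply: le; move: GH3; rewrite -(ler_nat R) natrD; lra.
have le4 : (u 4 - (H 4)%:R) / 4`!%:R <=
    (12 * m%:R - 2 * m%:R ^+ 2 - 12) / 4`!%:R.
  apply: le; move: GH4; rewrite -(ler_nat R) (natrD _ (G 4)) (natrD _ (H 4)).
  by rewrite (natrD _ (2 * m ^ 2)%N) (natrM _ 2%N) (natrM _ 12%N) natrX; lra.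
rewrite 5?big_nat_recr //= big_nil.
have := le0 0%N isT; have := le0 1%N isT; have := le0 2 isT.
move: le3 le4 tail.
set a := (_ / 0`!%:R); set b := (_ / 1`!%:R); set c := (_ / 2`!%:R).
set d := (u 3 - _) / _; set e := (u 4 - _) / _.
rewrite (_ : 3`! = 6%N) // (_ : 4`! = 24%N) //.
by have := sqr_ge0 (m%:R - 42 / 10 : R); nra.
Qed.

Theorem theorem2p6 (R : realType) (n : nat) (hn : (4 <= n)%N)
    (V : finType) (hV : #|V| = n) (Gamma : signed_graph V)
    (hGamma : unicyclic Gamma) :
  EE R Gamma <= EE R (Gamma3_plus n) /\
  (EE R Gamma = EE R (Gamma3_plus n) <->
   switching_equivalent Gamma (Gamma3_plus n)).
Proof.
pose a k := \sum_x signed_wk (weight R Gamma) k x x.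
pose b k := \sum_x signed_wk (weight R (Gamma3_plus n)) k x x.
pose H := trace_wk (@Gamma3_adj n).
have lim (W : finType) (S : signed_graph W) :
    ((fun K => \sum_(0 <= k < K) (\sum_x signed_wk (weight R S) k x x) / k`!%:R)
      @ \oo --> EE R S)%classic.
  rewrite (_ : (fun K => _) = trace_exp_sum (adjacency R S)).
    exact: EE_cvg.
  by apply/funext => K; apply: eq_bigr => k _; rewrite trace_adjacency_exp.
have limG := lim _ Gamma; have limH := lim _ (Gamma3_plus n).
have aG k : a k <= (trace_wk (adj Gamma) k)%:R.
  exact/signed_trace_le/weight_norm.
have bH k : b k = (H k)%:R.
  rewrite /H /trace_wk natr_sum; apply: eq_bigr => x _.
  apply: signed_wk_unsigned => {}x y.
  by rewrite /weight /edge_sign /=; case: (Gamma3_adj x y).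
have EEeq : switching_equivalent Gamma (Gamma3_plus n) ->
    EE R Gamma = EE R (Gamma3_plus n).
  move=> sw; rewrite -(cvg_lim _ limG) // -(cvg_lim _ limH) //.
  congr (limn _); apply/funext => K; apply: eq_bigr => k _.
  by rewrite (switching_equivalent_trace R k sw).
have [[GH G4]|[m mGH]] := unicyclic_trace_le
  (adj_sym Gamma) (adj_irrefl Gamma) (unicyclic_on_setT hGamma) hn hV.
  have ab k : a k <= b k by rewrite bH (le_trans (aG k)) // ler_nat.
  split; first exact: (exp_series_le limG limH).
  (* Equal sums force equal moments: the fourth ones give a universal vertex, the third ones
     positive triangles. *)
  split=> // EEE; have abE k : a k = b k := exp_series_eq limG limH ab EEE k.
  have aGE k : a k = (trace_wk (adj Gamma) k)%:R.
    by apply/eqP; rewrite eq_le aG abE bH ler_nat GH.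
  have [|u uG] := G4.
    by apply/eqP; rewrite -(eqr_nat R) -aGE abE bH.
  rewrite -hV; apply: (universal_switching hGamma uG) => [x y z xy yz zx|].
    have := signed_trace3_eq (@weight_norm R _ Gamma) (aGE 3) xy yz zx.
    rewrite /weight xy yz zx /edge_sign -!signr_addb.
    by case: (_ (+) _) => //=; rewrite expr1; lra.
  by rewrite hV ltnW.
(* In the remaining case the inequality is strict, so equality fails, and by [EEeq] so does
   switching equivalence. *)
have gap : EE R Gamma - EE R (Gamma3_plus n) <= - (3 / 100).
  apply: (exp_series_le_gap limG limH (K0 := 5)) => K.
  under eq_bigr do rewrite -/(b _) bH.
  exact: (partial_sum_gap K aG mGH).
split; first by lra.
by split=> // EEE; move: gap; rewrite EEE subrr; lra.
Qed.
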